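(* The map $\Gamma$ (polar complex on objects, $f\mapsto\hat f$ on morphisms) is a functor to $\mathbf{Simp}$ from the subcategory of $\mathbf{Hyp}$ that has the same objects and in which morphisms are required to be one-to-one.
   Context: $\mathbf{Hyp}$ is the category of finite hypergraphs without multi-edges. Objects are pairs $\mathcal{H}=(V,E)$ with $V$ a finite set and $E\subseteq\mathcal{P}(V)$ (the empty set is allowed as a hyperedge). A morphism from $(V,E)$ to $(V',E')$ is a function $f:V\to V'$ such that $\{f(v):v\in e\}\in E'$ for all $e\in E$. A morphism is one-to-one if the vertex map $f$ is injective. $\mathbf{Simp}$ is the category of abstract simplicial complexes. An object is a collection $K$ of nonempty subsets (simplices) of a base set $X$ closed under taking nonempty subsets. A morphism from $K_1$ on $X_1$ to $K_2$ on $X_2$ is a simplicial map, i.e. a function $g:X_1\to X_2$ such that $\{g(x):x\in\sigma\}\in K_2$ for every $\sigma\in K_1$. For $\mathcal{H}=(V,E)$ let $\overline{V}=\{\overline{v}:v\in V\}$ be a disjoint second copy of $V$, with the convention $\overline{\overline{v}}=v$; for $A\subseteq V$ write $\overline{A}=\{\overline{v}:v\in A\}$. For $e\in E$ set $\Sigma(e)=e\sqcup\overline{V\setminus e}$. The polar complex $\Gamma(\mathcal{H})$ is the simplicial complex on base set $V\sqcup\overline{V}$ whose simplices are all nonempty subsets of the sets $\Sigma(e)$, $e\in E$. For a morphism $f:V_1\to V_2$, $\Gamma(f)=\hat f:V_1\sqcup\overline{V_1}\to V_2\sqcup\overline{V_2}$ is defined by $\hat f(v)=f(v)$ and $\hat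 f(\overline{v})=\overline{f(v)}$ for $v\in V_1$. *)

(* Defs.v *)
From mathcomp Require Import all_boot.
From mathcomp Require Import boolp classical_sets.

Set Implicit Arguments.
Unset Strict Implicit.
Unset Printing Implicit Defensive.

Local Open Scope classical_set_scope.

Record category := Category {
  obj :> Type;
  hom : obj -> obj -> Type;
  idm : forall a, hom a a;
  compm : forall a b c, hom b c -> hom a b -> hom a c;
  comp1m : forall a b (f : hom a b), compm (idm b) f = f;
  compm1 : forall a b (f : hom a b), compm f (idm a) = f;
  compmA : forall a b c d (h : hom c d) (g : hom b c) (f : hom a b),
    compm h (compm g f) = compm (compm h g) f
}.
Arguments hom : clear implicits.
Arguments idm : clear implicits.

Record is_functor (C D : category) (F : C -> D)
    (Fmor : forall a b : C, hom C a b -> hom D (F a) (F b)) : Prop := IsFunctor {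
  functor_id : forall a : C, Fmor a a (idm C a) = idm D (F a);
  functor_comp : forall (a b c : C) (g : hom C b c) (f : hom C a b),
    Fmor a c (compm g f) = compm (Fmor b c g) (Fmor a b f)
}.

Section WideSubcategory.
Variables (C : category) (P : forall a b : C, hom C a b -> Prop).
Hypothesis P_id : forall a, P (idm C a).
Hypothesis P_comp : forall a b c (g : hom C b c) (f : hom C a b),
  P g -> P f -> P (compm g f).

Definition wide_hom (a b : C) : Type := {f : hom C a b | P f}.
Definition wide_id (a : C) : wide_hom a a := exist _ (idm C a) (P_id a).
Definition wide_comp (a b c : C) (g : wide_hom b c) (f : wide_hom a b) :
    wide_hom a c :=
  exist _ (compm (sval g) (sval f)) (P_comp (svalP g) (svalP f)).

Lemma wide_comp1m a b (f : wide_hom a b) : wide_comp (wide_id b) f = f.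
Proof. by case: f => f Pf; apply/eq_exist/comp1m. Qed.

Lemma wide_compm1 a b (f : wide_hom a b) : wide_comp f (wide_id a) = f.
Proof. by case: f => f Pf; apply/eq_exist/compm1. Qed.

Lemma wide_compmA a b c d
    (h : wide_hom c d) (g : wide_hom b c) (f : wide_hom a b) :
  wide_comp h (wide_comp g f) = wide_comp (wide_comp h g) f.
Proof. by apply: eq_exist; exact: compmA. Qed.

Definition wide_subcategory : category :=
  Category wide_comp1m wide_compm1 wide_compmA.
End WideSubcategory.

Record hypergraph := Hypergraph {
  vertex : finType;
  hyperedge : {set {set vertex}}
}.

Record hyp_hom (H1 H2 : hypergraph) := HypHom {
  hyp_fun :> vertex H1 -> vertex H2;
  hyp_funP : forall e, e \in hyperedge H1 -> hyp_fun @: e \in hyperedge H2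
}.

Lemma hyp_hom_ext H1 H2 (f g : hyp_hom H1 H2) : hyp_fun f = hyp_fun g -> f = g.
Proof.
by case: f g => [f fP] [g gP] /= fg; case: _ / fg in gP *; congr HypHom.
Qed.

Lemma hyp_id_subproof H e :
  e \in hyperedge H -> [set id x | x in e]%SET \in hyperedge H.
Proof. by rewrite imset_id. Qed.

Definition hyp_id H : hyp_hom H H := HypHom (@hyp_id_subproof H).

Lemma hyp_comp_subproof H1 H2 H3 (g : hyp_hom H2 H3) (f : hyp_hom H1 H2) e :
  e \in hyperedge H1 -> (g \o f) @: e \in hyperedge H3.
Proof. by move=> eE; rewrite imset_comp; do 2!apply: hyp_funP. Qed.

Definition hyp_comp H1 H2 H3 (g : hyp_hom H2 H3) (f : hyp_hom H1 H2) :
  hyp_hom H1 H3 := HypHom (hyp_comp_subproof g f).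

Lemma hyp_comp1m H1 H2 (f : hyp_hom H1 H2) : hyp_comp (hyp_id H2) f = f.
Proof. exact: hyp_hom_ext. Qed.

Lemma hyp_compm1 H1 H2 (f : hyp_hom H1 H2) : hyp_comp f (hyp_id H1) = f.
Proof. exact: hyp_hom_ext. Qed.

Lemma hyp_compmA H1 H2 H3 H4
    (h : hyp_hom H3 H4) (g : hyp_hom H2 H3) (f : hyp_hom H1 H2) :
  hyp_comp h (hyp_comp g f) = hyp_comp (hyp_comp h g) f.
Proof. exact: hyp_hom_ext. Qed.

Definition Hyp : category := Category hyp_comp1m hyp_compm1 hyp_compmA.

Definition one_to_one (H1 H2 : Hyp) (f : hom Hyp H1 H2) : Prop :=
  injective (hyp_fun f).

Lemma one_to_one_id (H : Hyp) : one_to_one (idm Hyp H).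
Proof. exact: inj_id. Qed.

Lemma one_to_one_comp (H1 H2 H3 : Hyp) (g : hom Hyp H2 H3) (f : hom Hyp H1 H2) :
  one_to_one g -> one_to_one f -> one_to_one (compm g f).
Proof. exact: inj_comp. Qed.

Definition HypInj : category := wide_subcategory one_to_one_id one_to_one_comp.

(* Neither the base set nor the simplices are required to be finite. *)
Record simplicial_complex := SimplicialComplex {
  base : Type;
  simplex : set (set base);
  simplex_neq0 : forall s, simplex s -> s !=set0;
  simplex_face : forall s t, simplex s -> t `<=` s -> t !=set0 -> simplex t
}.

Record simp_hom (K1 K2 : simplicial_complex) := SimpHom {
  simp_fun :> base K1 -> base K2;
  simp_funP : forall s, simplex s -> simplex (simp_fun @` s)
}.

Lemma simp_hom_ext K1 K2 (f g : simp_hom K1 K2) :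
  simp_fun f = simp_fun g -> f = g.
Proof.
by case: f g => [f fP] [g gP] /= fg; case: _ / fg in gP *; congr SimpHom.
Qed.

Lemma simp_id_subproof K (s : set (base K)) : simplex s -> simplex (id @` s).
Proof. by rewrite image_id. Qed.

Definition simp_id K : simp_hom K K := SimpHom (@simp_id_subproof K).

Lemma simp_comp_subproof K1 K2 K3 (g : simp_hom K2 K3) (f : simp_hom K1 K2) s :
  simplex s -> simplex ((g \o f) @` s).
Proof. by move=> sK; rewrite -image_comp; do 2!apply: simp_funP. Qed.

Definition simp_comp K1 K2 K3 (g : simp_hom K2 K3) (f : simp_hom K1 K2) :
  simp_hom K1 K3 := SimpHom (simp_comp_subproof g f).

Lemma simp_comp1m K1 K2 (f : simp_hom K1 K2) : simp_comp (simp_id K2) f = f.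
Proof. exact: simp_hom_ext. Qed.

Lemma simp_compm1 K1 K2 (f : simp_hom K1 K2) : simp_comp f (simp_id K1) = f.
Proof. exact: simp_hom_ext. Qed.

Lemma simp_compmA K1 K2 K3 K4
    (h : simp_hom K3 K4) (g : simp_hom K2 K3) (f : simp_hom K1 K2) :
  simp_comp h (simp_comp g f) = simp_comp (simp_comp h g) f.
Proof. exact: simp_hom_ext. Qed.

Definition Simp : category := Category simp_comp1m simp_compm1 simp_compmA.

(* The disjoint union of V and its second copy is V + V: a vertex v is        *)
(* [inl v] and its barred copy is [inr v].                                    *)
Definition Sigma (V : finType) (e : {set V}) : set (V + V) :=
  (inl @` [set` e]) `|` (inr @` [set` (~: e)%SET]).

Definition polar_simplex (H : hypergraph) : set (set (vertex H + vertex H)) :=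
  [set s | s !=set0 /\ exists2 e, e \in hyperedge H & s `<=` Sigma e].

Lemma polar_simplex_neq0 H s : @polar_simplex H s -> s !=set0.
Proof. by case. Qed.

Lemma polar_simplex_face H s t :
  @polar_simplex H s -> t `<=` s -> t !=set0 -> @polar_simplex H t.
Proof.
move=> [_ [e eE se]] ts t0; split => //.
by exists e => //; apply: subset_trans se.
Qed.

Definition polar_complex (H : hypergraph) : simplicial_complex :=
  SimplicialComplex (@polar_simplex_neq0 H) (@polar_simplex_face H).

Definition hat (V1 V2 : Type) (f : V1 -> V2) (x : V1 + V1) : V2 + V2 :=
  match x with inl v => inl (f v) | inr v => inr (f v) end.

(* Main.v *)
Require Import Defs.
From mathcomp Require Import all_boot.
From mathcomp Require Import boolp classical_sets.

Local Open Scope classical_set_scope.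

(** An injective [f] sends the complement of [e] into the complement of [f @: e], so [hat f] carries
    [Sigma e] into [Sigma (f @: e)], and [f @: e] is again a hyperedge. Hence [hat f] is simplicial
    ([hat_polar_simplex]). As [hat] applies [f] to each copy separately, it respects identities and
    composition. *)

(* Injectivity is what keeps the barred part in place: a vertex outside [e] is
   sent outside [f @: e]. *)
Lemma hat_Sigma (V1 V2 : finType) (f : V1 -> V2) (e : {set V1}) :
  injective f -> hat f @` Sigma e `<=` Sigma (f @: e).
Proof.
move=> f_inj _ [_ [[v ve <-]|[v ve <-]] <-] /=.
- by left; exists (f v) => //=; apply: imset_f.
- right; exists (f v) => //=.
  (* [mem_imset] needs [f_inj]: otherwise [f v] could also be the image of a vertex of [e]. *)
  by move: ve; rewrite /= !inE mem_imset.
Qed.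

Lemma hat_polar_simplex (H1 H2 : hypergraph) (f : hyp_hom H1 H2)
    (s : set (vertex H1 + vertex H1)) :
  injective f -> polar_simplex s -> polar_simplex (hat f @` s).
Proof.
move=> f_inj [[x sx] [e eE se]]; split; first by exists (hat f x); exists x.
exists (f @: e)%SET; first exact: hyp_funP.
exact: subset_trans (image_subset se) (hat_Sigma _ _ _ _ f_inj).
Qed.

Lemma hat_id (V : Type) : hat (@id V) = id.
Proof. by apply: funext => -[]. Qed.

Lemma hat_comp (V1 V2 V3 : Type) (g : V2 -> V3) (f : V1 -> V2) :
  hat (g \o f) = hat g \o hat f.
Proof. by apply: funext => -[]. Qed.

Definition polar_map (H1 H2 : HypInj) (f : hom HypInj H1 H2) :
    hom Simp (polar_complex H1) (polar_complex H2) :=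
  @SimpHom (polar_complex H1) (polar_complex H2) (hat (hyp_fun (sval f)))
    (fun s => @hat_polar_simplex H1 H2 (sval f) s (svalP f)).

(** The first conjunct pins [Gamma] down, since a simplicial map is determined by its vertex map
    ([simp_hom_ext]). *)
Theorem proposition25 :
  exists Gamma : forall H1 H2 : HypInj,
      hom HypInj H1 H2 -> hom Simp (polar_complex H1) (polar_complex H2),
    (forall (H1 H2 : HypInj) (f : hom HypInj H1 H2),
        simp_fun (Gamma H1 H2 f) = hat (hyp_fun (sval f))) /\
    is_functor (C := HypInj) (D := Simp) (F := polar_complex) Gamma.
Proof.
exists polar_map; split=> //; split=> [H|H1 H2 H3 g f]; apply: simp_hom_ext.
- exact: hat_id.
- exact: hat_comp.
Qed.
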